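(* Let $G\in\mathcal{G}$ and fix $H:\mathcal{U}\to W_k$ such that $\rho\circ H=G$. Then for each $\tau\in\mathrm{Aut}_{\mathfrak{s}_k}$ the function $$G_\tau=\rho\circ\tau\circ H$$ belongs to $\mathcal{G}$.
   Context: Points of $\mathbb{C}^4$ are written $z=(z_0,\underline{z})$ with $\underline{z}=(z_1,z_2,z_3)$, and $\underline{z}^2:=z_1^2+z_2^2+z_3^2$. For a positive integer $k$, the polynomials $p_0^k$ and $p_1^{k-1}$ in two variables are determined by $(x+\imath y)^k=p_0^k(x,y^2)+\imath\, y\,p_1^{k-1}(x,y^2)$ for $x,y\in\mathbb{R}$, and $\sigma_k:\mathbb{C}^4\to\mathbb{C}^4$ is $\sigma_k(z_0,\underline{z})=(p_0^k(z_0,\underline{z}^2),\ p_1^{k-1}(z_0,\underline{z}^2)\,\underline{z})$. Put $$\Omega=\{(z_0,\underline{z}):\ \underline{z}^2\ne0,\ z_0^2+\underline{z}^2\neq0,\ z_0\neq0\},\qquad \Omega_k=\{(z_0,\underline{z})\in\Omega:\ p_1^{k-1}(z_0,\underline{z}^2)\neq0\}.$$ Let $\mathcal{S}=\{s\in\mathbb{C}^3: s_1^2+s_2^2+s_3^2=1\}$ and $\rho:\mathbb{C}^2\times\mathcal{S}\to\mathbb{C}^4$, $\rho((u_0,u_1),s)=(u_0,u_1s)$. Put $W=\rho^{-1}(\Omega)$ and $W_k=\rho^{-1}(\Omega_k)$, and let $\mathfrak{s}_k((u_0,u_1),s)=((p_0^k(u_0,u_1^2),u_1p_1^{k-1}(u_0,u_1^2)),s)$,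 so that $\rho\circ\mathfrak{s}_k=\sigma_k\circ\rho$; it is considered as a covering map $\mathfrak{s}_k:W_k\to W$ of degree $k^2$. $\mathrm{Aut}_{\mathfrak{s}_k}$ is the group of automorphisms $\tau$ of $W_k$ such that $\mathfrak{s}_k\circ\tau=\mathfrak{s}_k$. Throughout, $\mathcal{U}\subset\mathbb{C}$ is a simply connected open domain invariant under complex conjugation or the union of two simply connected open domains symmetric with respect to the real line; here $\mathcal{U}$ is assumed simply connected. A slice function is given, with stem function $F:\mathcal{U}\to\mathbb{C}^4$ (i.e. $F(\overline z)=\overline{F(z)}$, where $\mathbb{C}^4\cong\mathbb{C}\otimes\mathbb{H}$), such that $F(\mathcal{U})\subseteq\Omega$, and $$\mathcal{G}=\{G:\mathcal{U}\to\Omega_k:\ \sigma_k\circ G=F\}.$$ *)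

(* Defs.v *)
From HB Require Import structures.
From mathcomp Require Import all_boot all_order all_algebra.
From mathcomp Require Import polyXY complex.
From mathcomp Require Import all_classical all_reals all_analysis.
From mathcomp Require Import ring.

Set Implicit Arguments.
Unset Strict Implicit.
Unset Printing Implicit Defensive.

Import Order.TTheory GRing.Theory Num.Theory.
Import numFieldNormedType.Exports.

Local Open Scope ring_scope.
Local Open Scope complex_scope.
Local Open Scope classical_set_scope.

Section PowerParts.
Variable A : comNzRingType.

(* The pair (p_0^k, p_1^{k-1}); for [p : {poly {poly A}}], [p.[x, t]] is the
   value at first variable x and second variable t. The recursion is
   multiplication by x + iy with t = y^2. *)
Fixpoint power_parts (k : nat) : {poly {poly A}} * {poly {poly A}} :=
  if k is k'.+1 then
    let p := power_parts k' in
    ('X * p.1 - 'Y * p.2, 'X * p.2 + p.1)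
  else (1, 0).

Definition p0 (k : nat) (x t : A) : A := (power_parts k).1.[x, t].

(* [p1 k] is p_1^{k-1}: the index is the exponent of x + iy, not the degree. *)
Definition p1 (k : nat) (x t : A) : A := (power_parts k).2.[x, t].

Lemma p0S k x t : p0 k.+1 x t = x * p0 k x t - t * p1 k x t.
Proof.
rewrite /p0 /p1 [power_parts k.+1]/=.
by rewrite !(hornerD, hornerN, hornerM, hornerC, hornerX).
Qed.

Lemma p1S k x t : p1 k.+1 x t = x * p1 k x t + p0 k x t.
Proof.
rewrite /p0 /p1 [power_parts k.+1]/=.
by rewrite !(hornerD, hornerN, hornerM, hornerC, hornerX).
Qed.

Lemma p00 x t : p0 0 x t = 1. Proof. by rewrite /p0 /= !hornerC. Qed.
Lemma p10 x t : p1 0 x t = 0. Proof. by rewrite /p1 /= horner0 horner0. Qed.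

Lemma power_parts_gen (j x y : A) k : j * j = -1 -> 
  (x + j * y) ^+ k = p0 k x (y ^+ 2) + j * y * p1 k x (y ^+ 2).
Proof.
move=> jj; elim: k => [|k IH]; first by rewrite expr0 p00 p10 mulr0 addr0.
rewrite exprS {}IH p0S p1S.
set a := p0 _ _ _; set b := p1 _ _ _.
have -> : (x + j * y) * (a + j * y * b) =
  x * a + (j * j) * (y ^+ 2 * b) + j * y * (x * b + a) by ring.
rewrite jj; ring.
Qed.
End PowerParts.

Lemma roots_nat_eq0 (D : idomainType) (p : {poly D}) (f : nat -> D) :
  injective f -> (forall n, p.[f n] = 0) -> p = 0.
Proof.
move=> fI pf; apply/eqP; apply: contraT => p0.
have := @max_poly_roots _ p (map f (iota 0 (size p))) p0.
rewrite map_inj_uniq // iota_uniq size_map size_iota ltnn => /(_ _ erefl) H.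
by apply: H; apply/allP => _ /mapP[n _ ->]; apply/rootP.
Qed.

Section Spec.
Variable R : realType.

Lemma xiy (x y : R) : x +i* y = x%:C + 'i * y%:C.
Proof. by apply/eqP; rewrite eq_complex /= !(mul0r, mulr0, mul1r, subr0, addr0, add0r) !eqxx. Qed.

(* [power_partsE] and [power_parts_uniq]: the pair [power_parts k] is the one
   determined by (x + iy)^k = p_0^k(x, y^2) + i y p_1^{k-1}(x, y^2) for real
   x, y. *)
Lemma power_partsE (k : nat) (x y : R) :
  (x +i* y) ^+ k =
    p0 k x%:C (y ^+ 2)%:C + 'i * y%:C * p1 k x%:C (y ^+ 2)%:C.
Proof.
rewrite xiy (@power_parts_gen _ 'i) ?rmorphXn //.
by rewrite -expr2 sqr_i.
Qed.

Lemma power_parts_uniq (k : nat) (q0 q1 : {poly {poly R[i]}}) :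
  (forall x y : R, (x +i* y) ^+ k =
     q0.[x%:C, (y ^+ 2)%:C] + 'i * y%:C * q1.[x%:C, (y ^+ 2)%:C]) ->
  (q0, q1) = power_parts R[i] k.
Proof.
move=> H.
have Z (d : {poly {poly R[i]}}) :
    (forall x y : R, y != 0 -> d.[x%:C, (y ^+ 2)%:C] = 0) -> d = 0.
  move=> Hd.
  apply: (@roots_nat_eq0 _ _ (fun m => ((m%:R)%:C)%:P)) => [m n|m].
    by move=> /polyC_inj /complexI /eqP; rewrite eqr_nat => /eqP.
  apply: (@roots_nat_eq0 _ _ (fun n => (n.+1%:R ^+ 2)%:C)) => [n l|n].
    move=> /complexI /eqP; rewrite eqrXn2 ?ler0n// eqr_nat.
    by move=> /eqP [].
  by apply: Hd; rewrite pnatr_eq0.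
have i0 : 'i != 0 :> R[i] by rewrite eq_complex /= oner_eq0 andbF.
have E x y : y != 0 -> q0.[x%:C, (y ^+ 2)%:C] = p0 k x%:C (y ^+ 2)%:C /\
    q1.[x%:C, (y ^+ 2)%:C] = p1 k x%:C (y ^+ 2)%:C.
  move=> y0; have := H x y; have := H x (- y); rewrite !power_partsE sqrrN.
  rewrite rmorphN /=.
  set a := _.[_, _]; set b := _.[_, _]; set c := p0 _ _ _; set d := p1 _ _ _.
  set e := y%:C => E1 E2.
  have e0 : 'i * e != 0 by rewrite mulf_neq0 // eq_complex /= negb_and y0.
  have ac : a = c.
    have : 2 * c = 2 * a.
      rewrite (_ : 2 * c = (c + 'i * - e * d) + (c + 'i * e * d)); last by ring.
      by rewrite E1 E2; ring.
    by move/mulfI => <- //; rewrite pnatr_eq0.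
  split=> //; apply: (mulfI e0); move: E2; rewrite ac => /addrI; by [].
rewrite [RHS]surjective_pairing; congr pair; apply/eqP; rewrite -subr_eq0;
  apply/eqP; apply: Z => x y /(E x y) [E0 E1].
  by rewrite hornerD hornerN hornerD hornerN E0 /p0 subrr.
by rewrite hornerD hornerN hornerD hornerN E1 /p1 subrr.
Qed.
End Spec.

(* [R[i]^o] is [R[i]] with the topology of its modulus; the bare type [R[i]]
   carries no topology in the library. *)
Notation Cplx R := (R[i]^o).

(* A point (z_0, (z_1, z_2, z_3)) of C^4, resp. ((u_0, u_1), s) of C^2 x C^3,
   with the product topologies. *)
Notation C4 R := (R[i]^o * 'rV[R[i]^o]_3)%type.
Notation C2C3 R := ((R[i]^o * R[i]^o) * 'rV[R[i]^o]_3)%type.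

Section SliceRoots.
Variable R : realType.
Local Notation C := (Cplx R).

Definition sqv (v : 'rV[C]_3) : C := \sum_(i < 3) v ord0 i ^+ 2.

Definition sigma (k : nat) (z : C4 R) : C4 R :=
  (p0 k z.1 (sqv z.2), (p1 k z.1 (sqv z.2) : C) *: z.2).

Definition Omega : set (C4 R) :=
  [set z | [/\ sqv z.2 != 0, z.1 ^+ 2 + sqv z.2 != 0 & z.1 != 0]].

Definition Omegak (k : nat) : set (C4 R) :=
  [set z | Omega z /\ p1 k z.1 (sqv z.2) != 0].

Definition Sph : set 'rV[C]_3 := [set s | sqv s = 1].

Definition rho (w : C2C3 R) : C4 R := (w.1.1, w.1.2 *: w.2).

Definition W : set (C2C3 R) := [set w | Sph w.2 /\ Omega (rho w)].

Definition Wk (k : nat) : set (C2C3 R) := [set w | Sph w.2 /\ Omegak k (rho w)].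

Definition sk (k : nat) (w : C2C3 R) : C2C3 R :=
  ((p0 k w.1.1 (w.1.2 ^+ 2), w.1.2 * p1 k w.1.1 (w.1.2 ^+ 2)), w.2).

(* Automorphisms of the covering [sk k : Wk k -> W], i.e. self-homeomorphisms
   of W_k over [sk k]; only the restriction of [tau] to W_k is meaningful. *)
Definition Aut (k : nat) : set (C2C3 R -> C2C3 R) :=
  [set tau |
    {within Wk k, continuous tau} /\
    (forall w, Wk k w -> Wk k (tau w)) /\
    (exists tau' : C2C3 R -> C2C3 R,
       [/\ {within Wk k, continuous tau'},
           (forall w, Wk k w -> Wk k (tau' w)),
           (forall w, Wk k w -> tau' (tau w) = w) &
           (forall w, Wk k w -> tau (tau' w) = w)]) /\
    (forall w, Wk k w -> sk k (tau w) = sk k w)].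

Definition simply_connected (X : set C) : Prop :=
  [/\ X !=set0,
      (forall x y, X x -> X y -> exists g : R -> C,
         [/\ {within `[0, 1], continuous g},
             (forall t, `[0, 1] t -> X (g t)), g 0 = x & g 1 = y]) &
      (forall g : R -> C,
         {within `[0, 1], continuous g} ->
         (forall t, `[0, 1] t -> X (g t)) -> g 0 = g 1 ->
         exists h : R * R -> C,
           [/\ {within `[0, 1] `*` `[0, 1], continuous h},
               (forall p, (`[0, 1] `*` `[0, 1]) p -> X (h p)),
               (forall t, `[0, 1] t -> h (t, 0) = g t),
               (forall t, `[0, 1] t -> h (t, 1) = g 0) &
               (forall s, `[0, 1] s -> h (0, s) = g 0 /\ h (1, s) = g 0)])].

Definition conj4 (z : C4 R) : C4 R := (conjc z.1, map_mx (@conjc R) z.2).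

Definition stem (U : set C) (F : C -> C4 R) : Prop :=
  forall z, U z -> F (conjc z) = conj4 (F z).

(* Only the values on U are constrained, and no regularity is imposed. *)
Definition calG (k : nat) (U : set C) (F : C -> C4 R) : set (C -> C4 R) :=
  [set G | (forall z, U z -> Omegak k (G z)) /\
           (forall z, U z -> sigma k (G z) = F z)].

End SliceRoots.

(* Main.v *)
Require Import Defs.
From mathcomp Require Import all_boot all_order all_algebra.
From mathcomp Require Import complex.
From mathcomp Require Import all_classical all_reals all_analysis.
Import Order.TTheory GRing.Theory Num.Theory.
Import numFieldNormedType.Exports.
Local Open Scope ring_scope.
Local Open Scope complex_scope.
Local Open Scope classical_set_scope.

(** The map [rho] semiconjugates [sk k] to [sigma k]: since [s] has square 1,
    the square of [u1 *: s] is [u1 ^+ 2], and both sides are computed from the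
    same two polynomials ([sigma_rho]). An automorphism [tau] preserves [Wk k],
    so [rho (tau (H z))] lies in [Omegak k], and it preserves the fibres of
    [sk k], so that
      [sigma (rho (tau (H z))) = rho (sk (tau (H z))) = rho (sk (H z))
         = sigma (rho (H z)) = sigma (G z) = F z].
    The continuity of the new root is that of a composite, where [tau] is
    continuous only relatively to [Wk k] ([within_continuous_comp_sub]) and
    [rho] is continuous everywhere ([rho_continuous]). *)

Lemma sqvZ (R : realType) (a : Cplx R) (v : 'rV[Cplx R]_3) :
  sqv (a *: v) = a ^+ 2 * sqv v.
Proof.
by rewrite /sqv mulr_sumr; apply: eq_bigr => i _; rewrite mxE exprMn.
Qed.

(** The commuting square of the covering. The condition on [w.2] is what makes
    the second argument of the polynomials agree: [sqv (u1 *: s)], used by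
    [sigma], is then the [u1 ^+ 2] used by [sk]. *)
Lemma sigma_rho (R : realType) (k : nat) (w : C2C3 R) :
  Sph w.2 -> sigma k (rho w) = rho (sk k w).
Proof.
by move=> Sw; rewrite /sigma /rho /= sqvZ Sw mulr1 scalerA mulrC.
Qed.

Lemma rho_continuous (R : realType) : continuous (@rho R).
Proof.
move=> w; apply: (@cvg_pair _ _ _ _ (nbhs w.1.1) (nbhs (w.1.2 *: w.2))).
  by apply: (cvg_comp _ fst (@cvg_fst _ _ _ _ _)); exact: cvg_fst.
apply: cvgZ; last exact: cvg_snd.
by apply: (cvg_comp _ snd (@cvg_fst _ _ _ _ _)); exact: cvg_snd.
Qed.

(** Relative continuity of [g] suffices for a composite: near a point of [A],
    the values of [f] on [A] stay in [B], so the limit of [f] along [A] is also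
    a limit along the trace of the neighbourhood filter on [B]. *)
Lemma within_continuous_comp_sub (X Y Z : topologicalType)
  (A : set X) (B : set Y) (f : X -> Y) (g : Y -> Z) :
  (forall x, A x -> B (f x)) ->
  {within A, continuous f} -> {within B, continuous g} ->
  {within A, continuous (g \o f)}.
Proof.
move=> fAB /subspace_continuousP cf /subspace_continuousP cg.
apply/subspace_continuousP => x Ax.
apply: cvg_comp (cg _ (fAB _ Ax)) => P BP.
have := cf x Ax _ BP; rewrite /nbhs /= /within /=.
by apply: filterS => y BPy Ay; exact: BPy (fAB _ Ay).
Qed.

Theorem proposition6p6 (R : realType) (k : nat) (hk : (0 < k)%N)
  (U : set (Cplx R)) (U_open : open U) (U_sc : simply_connected U)
  (U_conj : forall z, U z -> U (conjc z))
  (F : Cplx R -> C4 R) (F_stem : stem U F)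
  (F_Omega : forall z, U z -> Omega (F z))
  (G : Cplx R -> C4 R) (hG : calG k U F G)
  (H : Cplx R -> C2C3 R) (H_Wk : forall z, U z -> Wk k (H z))
  (H_lift : forall z, U z -> rho (H z) = G z)
  (tau : C2C3 R -> C2C3 R) (htau : Aut k tau) :
  calG k U F (rho (R := R) \o tau \o H) /\
  ({within U, continuous H} ->
   {within U, continuous (rho (R := R) \o tau \o H)}).
Proof.
have [tau_cont [tau_Wk [_ sk_tau]]] := htau.
split.
  split=> z Uz /=; first by have [] := tau_Wk _ (H_Wk _ Uz).
  have [SHz _] := H_Wk _ Uz; have [StauHz _] := tau_Wk _ (H_Wk _ Uz).
  rewrite sigma_rho // sk_tau; last exact: H_Wk.
  by rewrite -sigma_rho // H_lift //; exact: hG.2.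
move=> H_cont; rewrite -compA.
apply: within_continuous_comp; first by move=> w _; exact: rho_continuous.
exact: within_continuous_comp_sub H_Wk H_cont tau_cont.
Qed.
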